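(* Let $q\ge5$ be a prime power. Let $L_c$ be the line through $\mathbf{P}(1,0,0,1)$ and $\mathbf{P}(0,0,1,0)$, and for $\mu\in\mathbb{F}_q$ let $\ell_\mu$ be the line through $\mathbf{P}(0,\mu,0,1)$ and $\mathbf{P}(1,0,1,0)$. Let $\mu\in\mathbb{F}_q\setminus\{0,1\}$, with moreover $\mu\ne1/9$ when $q$ is odd and $q\not\equiv0\pmod3$. Then $L_c$ and $\ell_\mu$ belong to the same orbit of $G_q$ if and only if $q$ is odd, $\mu=-1/3$, and either $q\equiv-1\pmod{12}$ and $\mu$ is not a square in $\mathbb{F}_q$, or $q\equiv1\pmod{12}$, $\mu$ is a square in $\mathbb{F}_q$, $1/2$ is a cube in $\mathbb{F}_q$ and $-1/3$ is a fourth power in $\mathbb{F}_q$.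
   Context: Points of $\mathrm{PG}(3,q)$ are written $\mathbf{P}(x_0,x_1,x_2,x_3)$ in homogeneous coordinates over the field $\mathbb{F}_q$. The twisted cubic is $\mathscr{C}=\{\mathbf{P}(t^3,t^2,t,1):t\in\mathbb{F}_q\}\cup\{\mathbf{P}(1,0,0,0)\}$ and $G_q$ is the group of projectivities of $\mathrm{PG}(3,q)$ fixing $\mathscr{C}$. Two lines are in the same orbit if an element of $G_q$ maps one onto the other. *)

(* Defs.v *)
From HB Require Import structures.
From mathcomp Require Import all_boot all_order all_algebra.
Set Implicit Arguments. Unset Strict Implicit. Unset Printing Implicit Defensive.
Import GRing.Theory.
Local Open Scope ring_scope.

(* PG(3,q) over a finite field F (q = #|F|).  A point P(v) is represented by a
   nonzero row vector v : 'rV[F]_4; two vectors give the same point iff they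
   have the same row space, i.e. (v == w)%MS.  A projectivity is represented by
   an invertible matrix A acting by v |-> v *m A. *)

Definition pvec (F : fieldType) (a b c d : F) : 'rV[F]_4 :=
  \row_(i < 4) [:: a; b; c; d]`_i.

Definition on_cubic (F : finFieldType) (v : 'rV[F]_4) : bool :=
  (v != 0) &&
  ([exists t : F, (v == pvec (t ^+ 3) (t ^+ 2) t 1)%MS]
   || (v == pvec 1 0 0 0)%MS).

Definition in_Gq (F : finFieldType) (A : 'M[F]_4) : Prop :=
  A \in unitmx /\ forall v : 'rV[F]_4, on_cubic (v *m A) = on_cubic v.

(* the line through two points, as the row space of a 2x4 matrix *)
Definition line_through (F : fieldType) (u v : 'rV[F]_4) : 'M[F]_(2, 4) :=
  col_mx u v.

Definition same_orbit (F : finFieldType) (L1 L2 : 'M[F]_(2, 4)) : Prop :=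
  exists A : 'M[F]_4, in_Gq A /\ (L1 *m A == L2)%MS.

Definition L_c (F : fieldType) : 'M[F]_(2, 4) :=
  line_through (pvec 1 0 0 1) (pvec 0 0 1 0).

Definition ell (F : fieldType) (mu : F) : 'M[F]_(2, 4) :=
  line_through (pvec 0 mu 0 1) (pvec 1 0 1 0).

(* Main.v *)
(* An element of G_q, for q >= 5, is a scalar multiple of the third symmetric power of
   an invertible binary matrix (a, b; c, d).  It maps L_c onto ell_mu exactly when four
   cubic equations in a, b, c, d hold.  They have no solution in characteristic 2 or 3;
   otherwise one may take d = 1, and with u = c^2 elimination gives mu = -1/3 and
   3 u^2 + 6 u - 1 = 0, that is u = (2 - r) / r = (r - 1)^2 / (2 r) with r^2 = 3, while the
   scale k of (a, b) satisfies 2 k^3 (r - 1)^3 = 1.  So a solution exists exactly when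
   mu = -1/3, 12 is a fourth power (w^4 = 12 with w^2 = 2 r) and 1/2 is a cube.  The
   residue conditions come from: -1 is a square iff q = 1 mod 4, -3 is a square iff
   q = 1 mod 3, and -4 = (1 + i)^4, which links 12 = w^4 to -1/3 = ((1 + i) / w)^4. *)
Require Import Defs.
From HB Require Import structures.
From mathcomp Require Import all_boot all_order all_algebra all_field.
From mathcomp Require Import ring zify.
Import GRing.Theory.
Local Open Scope ring_scope.

(** * Symmetric cubes of binary matrices and their action on the twisted cubic *)

(** Homogeneous parameters treat the affine points (t, 1) and the point at infinity (1, 0)
    uniformly. *)
Definition cubic_pt {F : fieldType} (s t : F) : 'rV[F]_4 :=
  pvec (s ^+ 3) (s ^+ 2 * t) (s * t ^+ 2) (t ^+ 3).

(** With S = s a + t c and T = s b + t d, column j lists the coefficients of S^(3-j) T^j in the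
    monomials s^3, s^2 t, s t^2, t^3. *)
Definition sym3 {F : fieldType} (a b c d : F) : 'M[F]_4 :=
  \matrix_(i < 4)
   [:: pvec (a ^+ 3) (a ^+ 2 * b) (a * b ^+ 2) (b ^+ 3);
       pvec (3%:R * a ^+ 2 * c) (a ^+ 2 * d + 2%:R * a * b * c)
            (2%:R * a * b * d + b ^+ 2 * c) (3%:R * b ^+ 2 * d);
       pvec (3%:R * a * c ^+ 2) (2%:R * a * c * d + b * c ^+ 2)
            (a * d ^+ 2 + 2%:R * b * c * d) (3%:R * b * d ^+ 2);
       pvec (c ^+ 3) (c ^+ 2 * d) (c * d ^+ 2) (d ^+ 3)]`_i.

Lemma ord4P (P : 'I_4 -> Prop) :
  P 0 -> P 1 -> P 2%:R -> P 3%:R -> forall i, P i.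
Proof.
move=> P0 P1 P2 P3 [[|[|[|[|//]]]] lt_i].
- by rewrite (_ : Ordinal _ = 0) //; apply/val_inj.
- by rewrite (_ : Ordinal _ = 1) //; apply/val_inj.
- by rewrite (_ : Ordinal _ = 2%:R) //; apply/val_inj.
- by rewrite (_ : Ordinal _ = 3%:R) //; apply/val_inj.
Qed.

Lemma cubic_pt_sym3 (F : fieldType) (s t a b c d : F) :
  cubic_pt s t *m sym3 a b c d = cubic_pt (s * a + t * c) (s * b + t * d).
Proof.
apply/rowP; apply: ord4P; rewrite !mxE !big_ord_recl big_ord0;
  do ?rewrite !mxE /=; ring.
Qed.

Lemma sym3M (F : fieldType) (a b c d a' b' c' d' : F) :
  sym3 a b c d *m sym3 a' b' c' d' =
  sym3 (a * a' + b * c') (a * b' + b * d') (c * a' + d * c') (c * b' + d * d').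
Proof.
apply/matrixP; apply: ord4P; apply: ord4P;
  rewrite !mxE !big_ord_recl big_ord0;
  do ?rewrite !mxE /=; ring.
Qed.

Lemma sym3_scalar (F : fieldType) (k : F) : sym3 k 0 0 k = (k ^+ 3)%:M.
Proof.
apply/matrixP; apply: ord4P; apply: ord4P; do ?rewrite !mxE /=; ring.
Qed.

(** By functoriality the adjugate of the binary matrix gives the inverse up to a scalar. *)
Lemma sym3_adj (F : fieldType) (a b c d : F) :
  sym3 a b c d *m sym3 d (- b) (- c) a = ((a * d - b * c) ^+ 3)%:M.
Proof. by rewrite -sym3_scalar sym3M; congr sym3; ring. Qed.

Lemma sym3_adj_l (F : fieldType) (a b c d : F) :
  sym3 d (- b) (- c) a *m sym3 a b c d = ((a * d - b * c) ^+ 3)%:M.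
Proof. by rewrite -sym3_scalar sym3M; congr sym3; ring. Qed.

Lemma sym3_unit (F : fieldType) (a b c d : F) :
  a * d - b * c != 0 -> sym3 a b c d \in unitmx.
Proof.
move=> det0; have := sym3_adj F a b c d.
move=> /(congr1 (mulmx^~ ((a * d - b * c) ^- 3)%:M)).
rewrite -mulmxA -scalar_mxM mulfV ?expf_neq0 //.
by case/mulmx1_unit.
Qed.

Lemma on_cubicP (F : finFieldType) (v : 'rV[F]_4) :
  reflect (exists k s t, [/\ k != 0, (s != 0) || (t != 0) & v = k *: cubic_pt s t])
          (on_cubic v).
Proof.
have cub_inf : pvec 1 0 0 0 = cubic_pt 1 0 :> 'rV[F]_4.
  by rewrite /cubic_pt !expr0n !mulr0 expr1n.
have cub_aff t : pvec (t ^+ 3) (t ^+ 2) t 1 = cubic_pt t 1 :> 'rV[F]_4.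
  by rewrite /cubic_pt !expr1n !mulr1.
apply: (iffP andP) => [[v0 on_v]|[k [s [t [k0 st0 ->]]]]].
  have {}on_v : exists s t, ((s != 0) || (t != 0)) && (v <= cubic_pt s t)%MS.
    case/orP: on_v => [/existsP[t]|]; rewrite ?cub_inf ?cub_aff => /andP[vP _].
      by exists t, 1; rewrite oner_eq0 orbT.
    by exists 1, 0; rewrite oner_eq0.
  have [s [t /andP[st0 /sub_rVP[k vE]]]] := on_v.
  exists k, s, t; split=> //; apply: contraNneq v0 => k0.
  by rewrite vE k0 scale0r.
have [t0|t0] := eqVneq t 0.
  have s0 : s != 0 by rewrite t0 eqxx orbF in st0.
  have -> : k *: cubic_pt s t = (k * s ^+ 3) *: cubic_pt 1 0.
    by rewrite t0; apply/rowP; apply: ord4P; rewrite !mxE /=; ring.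
  rewrite -cub_inf; split; last first.
    by apply/orP; right; apply/eqmxP/eqmx_scale; rewrite mulf_neq0 ?expf_neq0.
  rewrite scaler_eq0 mulf_eq0 expf_eq0 /= (negPf k0) (negPf s0) /=.
  by apply/eqP => /rowP/(_ 0)/eqP; rewrite !mxE oner_eq0.
have -> : k *: cubic_pt s t = (k * t ^+ 3) *: cubic_pt (s / t) 1.
  by apply/rowP; apply: ord4P; rewrite !mxE /=; field.
rewrite -cub_aff; split.
  rewrite scaler_eq0 mulf_eq0 expf_eq0 /= (negPf k0) (negPf t0) /=.
  by apply/eqP => /rowP/(_ 3%:R)/eqP; rewrite !mxE oner_eq0.
apply/orP; left; apply/existsP; exists (s / t).
by apply/eqmxP/eqmx_scale; rewrite mulf_neq0 ?expf_neq0.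
Qed.

Lemma on_cubicZ (F : finFieldType) (k : F) (v : 'rV[F]_4) :
  k != 0 -> on_cubic (k *: v) = on_cubic v.
Proof.
have imp l (w : 'rV[F]_4) : l != 0 -> on_cubic w -> on_cubic (l *: w).
  move=> l0 /on_cubicP[m [s [t [m0 st0 ->]]]]; apply/on_cubicP.
  by exists (l * m), s, t; rewrite mulf_neq0 // scalerA.
move=> k0; apply/idP/idP; last exact: imp.
by move/(imp k^-1); rewrite scalerA mulVf // scale1r invr_eq0; apply.
Qed.

Lemma on_cubic_sym3 (F : finFieldType) (a b c d : F) (v : 'rV[F]_4) :
  a * d - b * c != 0 -> on_cubic v -> on_cubic (v *m sym3 a b c d).
Proof.
move=> det0 /on_cubicP[k [s [t [k0 st0 ->]]]]; apply/on_cubicP.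
exists k, (s * a + t * c), (s * b + t * d).
rewrite -scalemxAl cubic_pt_sym3; split=> //.
rewrite -negb_and; apply: contraL st0 => /andP[/eqP e1 /eqP e2].
rewrite -negb_and negbK.
(* Cramer's rule: if both new parameters vanish, so do s and t. *)
have sE : s * (a * d - b * c) = (s * a + t * c) * d - (s * b + t * d) * c by ring.
have tE : t * (a * d - b * c) = (s * b + t * d) * a - (s * a + t * c) * b by ring.
move/eqP: sE; move/eqP: tE; rewrite e1 e2 !mul0r subrr !mulf_eq0 (negPf det0).
by rewrite !orbF => -> ->.
Qed.

Lemma sym3_in_Gq (F : finFieldType) (a b c d : F) :
  a * d - b * c != 0 -> in_Gq (sym3 a b c d).
Proof.
move=> det0; split=> [|v]; first exact: sym3_unit.
apply/idP/idP; last exact: on_cubic_sym3.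
have det0' : d * a - (- b) * (- c) != 0 by rewrite mulrNN mulrC.
move/(on_cubic_sym3 _ _ _ _ _ _ det0'); rewrite -mulmxA sym3_adj mul_mx_scalar.
by rewrite on_cubicZ // expf_neq0.
Qed.

(** * Every element of G_q is a scaled symmetric cube *)

(** A nonzero polynomial of degree at most 3 cannot have q - 1 >= 4 roots; this is where q >= 5
    enters. *)
Lemma cubic_vanishing_coef (F : finFieldType) (a b c d : F) : (5 <= #|F|)%N ->
  (forall t, t != 0 -> a * t ^+ 3 + b * t ^+ 2 + c * t + d = 0) ->
  [/\ a = 0, b = 0, c = 0 & d = 0].
Proof.
move=> F5 root_t; pose p := Poly [:: d; c; b; a].
have p_t t : p.[t] = a * t ^+ 3 + b * t ^+ 2 + c * t + d.
  by rewrite horner_Poly /=; ring.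
have p0 : p = 0.
  apply/eqP/contraT=> p0.
  pose rs := enum [pred x : F | x != 0].
  have : (size rs < size p)%N.
    apply: max_poly_roots => //; last exact: enum_uniq.
    by apply/allP=> t; rewrite mem_enum inE => t0; rewrite /root p_t root_t.
  have -> : size rs = #|F|.-1 by rewrite -cardE -(cardC1 (0 : F)); apply: eq_card.
  have := size_Poly [:: d; c; b; a]; rewrite -/p /= => sz_p lt_p.
  have := leq_trans lt_p sz_p.
  by rewrite prednK ?(leq_trans _ F5) // => /(leq_trans F5).
have cf i : [:: d; c; b; a]`_i = 0 by rewrite -coef_Poly -/p p0 coef0.
by split; [apply: (cf 3) | apply: (cf 2) | apply: (cf 1) | apply: (cf 0)].
Qed.

Lemma on_cubic_quadrics (F : finFieldType) (v : 'rV[F]_4) : on_cubic v ->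
  v 0 0 * v 0 2%:R = v 0 1 ^+ 2 /\ v 0 1 * v 0 3%:R = v 0 2%:R ^+ 2.
Proof.
by move=> /on_cubicP[k [s [t [_ _ ->]]]]; rewrite !mxE /=; split; ring.
Qed.

Lemma mulmx_row4 (F : fieldType) n (v : 'rV[F]_4) (B : 'M[F]_(4, n)) j :
  (v *m B) 0 j =
  v 0 0 * B 0 j + v 0 1 * B 1 j + v 0 2%:R * B 2%:R j + v 0 3%:R * B 3%:R j.
Proof.
rewrite !mxE !big_ord_recl big_ord0 addr0 !addrA.
by congr (_ * _ + _ * _ + _ * _ + _ * _);
  congr (fun_of_matrix _ _ _); apply/val_inj.
Qed.

(* Pulled back along B, the quadrics x0 x2 = x1^2 and x1 x3 = x2^2 become, after
   division by t^2 and by t, cubics in t with q - 1 >= 4 roots, so they vanish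
   identically. *)
Lemma Gq_fix_0_inf (F : finFieldType) (B : 'M[F]_4) (x y : F) :
  (5 <= #|F|)%N -> in_Gq B -> x != 0 -> y != 0 ->
  cubic_pt 1 0 *m B = x *: cubic_pt 1 0 -> cubic_pt 0 1 *m B = y *: cubic_pt 0 1 ->
  exists k c, [/\ k != 0, c != 0 & B = k *: sym3 c 0 0 1].
Proof.
move=> F5 [B_unit B_Gq] x0 y0 B_inf B_0.
have row0 j : B 0 j = x * (cubic_pt 1 0 : 'rV[F]_4) 0 j.
  move/rowP/(_ j): B_inf; rewrite mulmx_row4 [RHS]mxE => <-; rewrite !mxE /=; ring.
have row3 j : B 3%:R j = y * (cubic_pt 0 1 : 'rV[F]_4) 0 j.
  move/rowP/(_ j): B_0; rewrite mulmx_row4 [RHS]mxE => <-; rewrite !mxE /=; ring.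
have [B00 B01 B02 B03] : [/\ B 0 0 = x, B 0 1 = 0, B 0 2%:R = 0 & B 0 3%:R = 0].
  by rewrite !row0 !mxE /=; split; ring.
have [B30 B31 B32 B33] :
    [/\ B 3%:R 0 = 0, B 3%:R 1 = 0, B 3%:R 2%:R = 0 & B 3%:R 3%:R = y].
  by rewrite !row3 !mxE /=; split; ring.
have quad t : t != 0 ->
    (x * t ^+ 2 + B 1 0 * t + B 2%:R 0) * (B 1 2%:R * t + B 2%:R 2%:R)
      = (B 1 1 * t + B 2%:R 1) ^+ 2 /\
    (B 1 1 * t + B 2%:R 1) * (B 1 3%:R * t ^+ 2 + B 2%:R 3%:R * t + y)
      = t * (B 1 2%:R * t + B 2%:R 2%:R) ^+ 2.
  move=> t0; have : on_cubic (cubic_pt t 1 *m B).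
    rewrite B_Gq; apply/on_cubicP; exists 1, t, 1.
    by rewrite scale1r oner_eq0 t0.
  move/on_cubic_quadrics; rewrite !mulmx_row4 B00 B01 B02 B03 B30 B31 B32 B33.
  rewrite !mxE /= => -[q1 q2]; split.
    by apply: (mulfI (expf_neq0 2 t0)); move: q1; congr (_ = _); ring.
  by apply: (mulfI t0); move: q2; congr (_ = _); ring.
have [|/eqP e3 e2 e1 e0] := @cubic_vanishing_coef F (x * B 1 2%:R)
  (x * B 2%:R 2%:R + B 1 0 * B 1 2%:R - B 1 1 ^+ 2)
  (B 1 0 * B 2%:R 2%:R + B 2%:R 0 * B 1 2%:R - 2%:R * B 1 1 * B 2%:R 1)
  (B 2%:R 0 * B 2%:R 2%:R - B 2%:R 1 ^+ 2) F5.
  by move=> t /quad[/eqP]; rewrite -subr_eq0 => /eqP <- _; ring.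
move: e3; rewrite mulf_eq0 (negPf x0) /= => /eqP B12.
have [|f3 f2 f1 /eqP f0] := @cubic_vanishing_coef F (B 1 1 * B 1 3%:R - B 1 2%:R ^+ 2)
  (B 1 1 * B 2%:R 3%:R + B 2%:R 1 * B 1 3%:R - 2%:R * B 1 2%:R * B 2%:R 2%:R)
  (B 1 1 * y + B 2%:R 1 * B 2%:R 3%:R - B 2%:R 2%:R ^+ 2)
  (B 2%:R 1 * y) F5.
  by move=> t /quad[_ /eqP]; rewrite -subr_eq0 => /eqP <-; ring.
move: f0; rewrite mulf_eq0 (negPf y0) orbF => /eqP B21.
move: e0 e1 e2 f1 f2 f3.
rewrite B12 B21 !(expr0n, mul0r, mulr0, addr0, add0r, subr0) /=.
move=> e0 e1 /eqP; rewrite subr_eq0 => /eqP e2 /eqP; rewrite subr_eq0 => /eqP f1 f2 f3.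
(* Otherwise column 1 of the invertible matrix B would be zero. *)
have B11 : B 1 1 != 0.
  apply/eqP=> B11; have /matrixP/(_ 1 1) := mulVmx B_unit.
  rewrite [RHS]mxE mxE big1 => [/esym/eqP|i _]; first by rewrite oner_eq0.
  by have -> : B i 1 = 0; [move: i; apply: ord4P | rewrite mulr0].
have B22 : B 2%:R 2%:R != 0.
  by apply: contraNneq B11 => B22; rewrite -sqrf_eq0 -e2 B22 mulr0.
move/eqP: e0; rewrite mulf_eq0 (negPf B22) orbF => /eqP B20.
move/eqP: e1; rewrite mulf_eq0 (negPf B22) orbF => /eqP B10.
move/eqP: f2; rewrite mulf_eq0 (negPf B11) => /eqP B23.
move/eqP: f3; rewrite mulf_eq0 (negPf B11) => /eqP B13.
(* B is now diagonal, and [e2], [f1] put its diagonal in geometric progression k c^3, k c^2, k c,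
   k. *)
exists (B 2%:R 2%:R ^+ 2 / B 1 1), (B 1 1 / B 2%:R 2%:R).
rewrite !mulf_neq0 ?invr_eq0 ?expf_neq0 //; split=> //.
have xE : x = B 1 1 ^+ 2 / B 2%:R 2%:R by rewrite -e2 mulfK.
have yE : y = B 2%:R 2%:R ^+ 2 / B 1 1 by rewrite -f1 mulrC mulKf.
apply/matrixP; apply: ord4P; apply: ord4P; do ?rewrite !mxE /=;
  rewrite ?(B00, B01, B02, B03, B30, B31, B32, B33, B10, B12, B13, B20, B21, B23);
  rewrite ?xE ?yE;
  try ring; field; rewrite ?B11 ?B22 //.
Qed.

Lemma in_GqM (F : finFieldType) (A B : 'M[F]_4) :
  in_Gq A -> in_Gq B -> in_Gq (A *m B).
Proof.
move=> [uA GA] [uB GB]; split=> [|v]; first by rewrite unitmx_mul uA.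
by rewrite mulmxA GB GA.
Qed.

Lemma cubic_ptZ (F : fieldType) (k s t : F) :
  cubic_pt (k * s) (k * t) = k ^+ 3 *: cubic_pt s t.
Proof. by apply/rowP; apply: ord4P; rewrite !mxE /=; ring. Qed.

Lemma cubic_pt_parallel (F : fieldType) (s t s' t' : F) :
  (s' != 0) || (t' != 0) -> s * t' - t * s' = 0 ->
  exists l, cubic_pt s t = l *: cubic_pt s' t'.
Proof.
move=> st0 /eqP; rewrite subr_eq0 => /eqP det0.
have [s0|s0] := eqVneq s' 0.
  have t0 : t' != 0 by rewrite s0 eqxx in st0.
  exists ((t / t') ^+ 3); rewrite -cubic_ptZ divfK //; congr cubic_pt.
  by apply: (mulIf t0); rewrite det0 s0 !mulr0 mul0r.
exists ((s / s') ^+ 3); rewrite -cubic_ptZ divfK //; congr cubic_pt.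
by apply: (mulIf s0); rewrite -det0 mulrAC divfK.
Qed.

(* Composing with an element of PGL(2,q) reduces to a projectivity fixing
   P(1,0,0,0) and P(0,0,0,1). *)
Lemma in_Gq_sym3 (F : finFieldType) (A : 'M[F]_4) : (5 <= #|F|)%N -> in_Gq A ->
  exists k a b c d, [/\ k != 0, a * d - b * c != 0 & A = k *: sym3 a b c d].
Proof.
move=> F5 GA; have [A_unit A_cubic] := GA.
have im (s t : F) : (s != 0) || (t != 0) -> exists k s' t',
    [/\ k != 0, (s' != 0) || (t' != 0) & cubic_pt s t *m A = k *: cubic_pt s' t'].
  move=> st0; apply/on_cubicP; rewrite A_cubic; apply/on_cubicP.
  by exists 1, s, t; rewrite oner_eq0 scale1r.
have [|x [a [b [x0 ab0 A_inf]]]] := im 1 0; first by rewrite oner_eq0.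
have [|y [c [d [y0 cd0 A_0]]]] := im 0 1; first by rewrite oner_eq0 orbT.
(* Two distinct points cannot have proportional images under the invertible A. *)
have det0 : a * d - b * c != 0.
  apply/eqP => /(cubic_pt_parallel _ _ _ _ _ cd0)[l pt_l].
  have : cubic_pt 1 0 *m A = (x * l / y) *: cubic_pt 0 1 *m A.
    by rewrite -scalemxAl A_inf A_0 pt_l !scalerA divfK.
  move/(can_inj (mulmxK A_unit))/rowP/(_ 0)/eqP; rewrite !mxE /=.
  by rewrite expr1n expr0n mulr0 oner_eq0.
have det0' : d * a - (- b) * (- c) != 0 by rewrite mulrNN mulrC.
pose D := (a * d - b * c) ^+ 3; have D0 : D != 0 by rewrite expf_neq0.
(* The adjugate sends the images (a, b) and (c, d) back to multiples of (1, 0) and (0, 1). *)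
pose B := A *m sym3 d (- b) (- c) a.
have [||||||k [e [k0 e0 BE]]] := @Gq_fix_0_inf F B (x * D) (y * D);
  rewrite ?mulf_neq0 //.
- exact/in_GqM/sym3_in_Gq.
- rewrite mulmxA A_inf -scalemxAl cubic_pt_sym3 -scalerA -cubic_ptZ.
  by congr (_ *: cubic_pt _ _); ring.
- rewrite mulmxA A_0 -scalemxAl cubic_pt_sym3 -scalerA -cubic_ptZ.
  by congr (_ *: cubic_pt _ _); ring.
exists (k / D), (e * a), (e * b), c, d.
rewrite !mulf_neq0 ?invr_eq0 //; split=> //.
  by rewrite -!mulrA -mulrBr mulf_neq0.
have : B *m sym3 a b c d = D *: A.
  by rewrite -mulmxA sym3_adj_l mul_mx_scalar.
rewrite BE -scalemxAl sym3M => /(congr1 (fun X => D^-1 *: X)).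
rewrite !scalerA mulVf // scale1r mulrC => <-.
by congr (_ *: sym3 _ _ _ _); ring.
Qed.

(** * From orbits of lines to four cubic equations *)

(* Membership in ell mu of the images under sym3 a b c d of the points spanning L_c. *)
Definition transporter_eqs {F : fieldType} (mu a b c d : F) :=
  [/\ a ^+ 3 + c ^+ 3 = a * b ^+ 2 + c * d ^+ 2,
    a ^+ 2 * b + c ^+ 2 * d = mu * (b ^+ 3 + d ^+ 3),
    3%:R * a * c ^+ 2 = a * d ^+ 2 + 2%:R * b * c * d
    & 2%:R * a * c * d + b * c ^+ 2 = mu * (3%:R * b * d ^+ 2)].

Lemma sub_ell (F : fieldType) (mu : F) (v : 'rV[F]_4) :
  (v <= ell mu)%MS = (v 0 0 == v 0 2%:R) && (v 0 1 == mu * v 0 3%:R).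
Proof.
apply/idP/andP => [/submxP[w ->]|[/eqP v02 /eqP v13]].
  rewrite /ell /line_through.
  rewrite -[w](@hsubmxK F 1 1 1) (@mul_row_col F 1 1 1 4) !mxE !big_ord1 !mxE /=.
  by split; apply/eqP; ring.
have -> : v = v 0 3%:R *: pvec 0 mu 0 1 + v 0 2%:R *: pvec 1 0 1 0.
  apply/rowP; apply: ord4P; rewrite !mxE /= ?v02 ?v13; ring.
rewrite /ell /line_through -(@addsmxE F 1 1 4).
by apply: addmx_sub_adds; apply: scalemx_sub.
Qed.

(** Columns 0 and 2 already form an identity matrix. The rank serves to turn an inclusion of lines
    into an equality. *)
Lemma rank_L_c (F : fieldType) : \rank (L_c F) = 2.
Proof.
apply/eqP/row_freeP; exists (row_mx (pvec 1 0 0 0)^T (pvec 0 0 1 0)^T).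
rewrite /L_c /line_through (@mul_col_row F 1 1 4 1 1) (@scalar_mx_block F 1 1).
by congr (@block_mx _ 1 1 1 1 _ _ _ _); apply/matrixP=> i j;
  rewrite !ord1 mulmx_row4 !mxE /= !(mul0r, mul1r, addr0, add0r).
Qed.

Lemma same_orbit_iff (F : finFieldType) (mu : F) : (5 <= #|F|)%N ->
  same_orbit (L_c F) (ell mu) <->
  exists a b c d, a * d - b * c != 0 /\ transporter_eqs mu a b c d.
Proof.
move=> F5.
have sub_sym3 a b c d : (L_c F *m sym3 a b c d <= ell mu)%MS =
  [&& a ^+ 3 + c ^+ 3 == a * b ^+ 2 + c * d ^+ 2,
    a ^+ 2 * b + c ^+ 2 * d == mu * (b ^+ 3 + d ^+ 3),
    3%:R * a * c ^+ 2 == a * d ^+ 2 + 2%:R * b * c * d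
    & 2%:R * a * c * d + b * c ^+ 2 == mu * (3%:R * b * d ^+ 2)].
  rewrite /L_c /line_through (@mul_col_mx F 1 1) (@col_mx_sub F 1 1 4).
  rewrite !sub_ell !mulmx_row4 -!andbA.
  by rewrite !mxE /= !(mul1r, mul0r, addr0, add0r) -!mulrA.
split=> [[A [GA /andP[]]]|[a [b [c [d [det0 [e1 e2 e3 e4]]]]]]].
  have [k [a [b [c [d [k0 det0 ->]]]]]] := in_Gq_sym3 _ _ F5 GA.
  rewrite -scalemxAr eqmx_scale // sub_sym3 => /and4P[/eqP ? /eqP ? /eqP ? /eqP ?] _.
  by exists a, b, c, d.
exists (sym3 a b c d); split; first exact: sym3_in_Gq.
have sub : (L_c F *m sym3 a b c d <= ell mu)%MS by rewrite sub_sym3 e1 e2 e3 e4 !eqxx.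
(* The image has rank 2 and [ell mu] has only two rows, so inclusion forces equality. *)
rewrite -(geq_leqif (mxrank_leqif_eq sub)).
by rewrite mxrankMfree ?row_free_unit ?sym3_unit // rank_L_c rank_leq_row.
Qed.

(** * Elimination in the four cubic equations *)

(** The multipliers passed to this lemma and to [eq_lincomb2] are cofactors expressing the goal in
    the ideal of known equations; what remains is an identity for [ring] or [field]. *)
Lemma eq_lincomb {R : comPzRingType} (k : R) {l r l' r' : R} :
  l = r -> l' - r' = k * (l - r) -> l' = r'.
Proof. by move=> -> /eqP; rewrite subrr mulr0 subr_eq0 => /eqP. Qed.

Lemma eq_lincomb2 {R : comPzRingType} (k1 k2 : R) {l1 r1 l2 r2 l r : R} :
  l1 = r1 -> l2 = r2 -> l - r = k1 * (l1 - r1) + k2 * (l2 - r2) -> l = r.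
Proof.
move=> -> ->; rewrite !subrr !mulr0 addr0.
by move/eqP; rewrite subr_eq0 => /eqP.
Qed.

(** In characteristic 2 the last two equations become a (c - d)^2 = 0 and b (c^2 - mu d^2) = 0; each
    of the four cases makes the determinant vanish. *)
Lemma transporter_two_neq0 (F : fieldType) (mu a b c d : F) :
  mu != 1 -> a * d - b * c != 0 -> transporter_eqs mu a b c d -> 2%:R != 0 :> F.
Proof.
move=> mu1 det0 [e1 e2 e3 e4]; apply: contra_neqN det0 => /eqP two0.
have mu1' : 1 - mu != 0 by rewrite subr_eq0 eq_sym.
have : (a == 0) || (c == d).
  rewrite -(subr_eq0 c) -(sqrf_eq0 (c - d)) -mulf_eq0; apply/eqP.
  by apply: (eq_lincomb2 1 (a * d ^+ 2 + b * c * d - a * c ^+ 2 - a * c * d) e3 two0); ring.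
have : (b == 0) || (c ^+ 2 == mu * d ^+ 2).
  rewrite -(subr_eq0 (c ^+ 2)) -mulf_eq0; apply/eqP.
  by apply: (eq_lincomb2 1 (mu * b * d ^+ 2 - a * c * d) e4 two0); ring.
move=> /orP[/eqP b0|/eqP c2] /orP[/eqP a0|/eqP cd].
- by rewrite a0 b0 !mul0r subrr.
- have /eqP : d ^+ 3 * (1 - mu) = 0.
    by apply: (eq_lincomb 1 e2); rewrite b0 cd; ring.
  by rewrite mulf_eq0 (negPf mu1') orbF expf_eq0 b0 => /= /eqP ->; ring.
- have /eqP : c * d ^+ 2 * (1 - mu) = 0.
    apply: (eq_lincomb2 (- 1) c e1 c2); rewrite a0; ring.
  rewrite mulf_eq0 (negPf mu1') orbF mulf_eq0 sqrf_eq0 a0 => /= /orP[]/eqP z0.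
    by rewrite z0; ring.
  move: c2 => /eqP; rewrite z0 expr0n /= mulr0 expf_eq0 /= => /eqP ->; ring.
- have /eqP : d ^+ 2 * (1 - mu) = 0.
    by apply: (eq_lincomb 1 c2); rewrite cd; ring.
  by rewrite mulf_eq0 (negPf mu1') orbF expf_eq0 cd => /= /eqP ->; ring.
Qed.

(** In characteristic 3 the third equation reads d (a d - b c) = 0, so d = 0; the fourth then gives
    b c^2 = 0. *)
Lemma transporter_three_neq0 (F : fieldType) (mu a b c d : F) :
  a * d - b * c != 0 -> transporter_eqs mu a b c d -> 3%:R != 0 :> F.
Proof.
move=> det0 [_ _ e3 e4]; apply: contra_neqN det0 => /eqP three0.
have /eqP : d * (a * d - b * c) = 0.
  by apply: (eq_lincomb2 (-1) (a * c ^+ 2 - b * c * d) e3 three0); ring.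
rewrite mulf_eq0 => /orP[/eqP d0|/eqP //].
have /eqP : b * c ^+ 2 = 0.
  by apply: (eq_lincomb 1 e4); rewrite d0; ring.
by rewrite mulf_eq0 expf_eq0 d0 => /= /orP[]/eqP ->; ring.
Qed.

(** If d = 0 the fourth equation kills b c, and if c = 0 the third kills a d. The equations are
    homogeneous, so one may divide by d. *)
Lemma transporter_normalize (F : fieldType) (mu a b c d : F) :
  3%:R != 0 :> F -> a * d - b * c != 0 -> transporter_eqs mu a b c d ->
  exists a' b' c', [/\ c' != 0, a' - b' * c' != 0 & transporter_eqs mu a' b' c' 1].
Proof.
move=> three0 det0 [e1 e2 e3 e4].
have d0 : d != 0.
  apply: contraNneq det0 => d0; rewrite d0 mulr0 sub0r oppr_eq0 mulf_eq0.
  have /eqP : b * c ^+ 2 = 0 by apply: (eq_lincomb 1 e4); rewrite d0; ring.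
  by rewrite mulf_eq0 expf_eq0.
have c0 : c != 0.
  apply: contraNneq det0 => c0; rewrite c0 mulr0 subr0 mulf_eq0.
  have /eqP : a * d ^+ 2 = 0 by apply: (eq_lincomb (-1) e3); rewrite c0; ring.
  by rewrite mulf_eq0 expf_eq0.
have d30 : d ^+ 3 != 0 by rewrite expf_neq0.
exists (a / d), (b / d), (c / d); split; first by rewrite mulf_neq0 ?invr_eq0.
  apply: contraNneq det0 => det0; apply/eqP.
  by rewrite -(mulr0 (d ^+ 2)) -det0; field.
split; apply: (mulfI d30).
- by move: e1; congr (_ = _); field.
- by move: e2; congr (_ = _); field.
- by move: e3; congr (_ = _); field.
- by move: e4; congr (_ = _); field.
Qed.

(* Up to a scalar the last two equations give (a, b) = k (2c, 3c^2 - 1); with u = c^2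
   the first two then reduce to 2 k^3 (9u - 1) = 1 and 3 u^2 + 6 u - 1 = 0. *)
Lemma transporter_param (F : fieldType) (mu a b c : F) :
  2%:R != 0 :> F -> 3%:R != 0 :> F -> mu != 1 ->
  c != 0 -> a - b * c != 0 -> transporter_eqs mu a b c 1 ->
  exists k, [/\ 2%:R * k ^+ 3 * (9%:R * c ^+ 2 - 1) = 1,
    3%:R * c ^+ 4 + 6%:R * c ^+ 2 = 1 & mu * 3%:R = - 1].
Proof.
move=> two0 three0 mu1 c0 det0 [e1 e2 e3 e4].
have mu1' : 1 - mu != 0 by rewrite subr_eq0 eq_sym.
have tc0 : 2%:R * c != 0 by rewrite mulf_neq0.
have [k aE] : exists k, a = 2%:R * c * k by exists (a / (2%:R * c)); field; rewrite c0.
have bE : b = (3%:R * c ^+ 2 - 1) * k.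
  by apply: (mulfI tc0); apply: (eq_lincomb (-1) e3); rewrite aE; ring.
have k0 : k != 0.
  by apply: contraNneq det0 => k0; rewrite aE bE k0 !mulr0 mul0r subrr.
have E1 : c ^+ 2 * (c ^+ 2 + 1) = mu * (3%:R * c ^+ 2 - 1).
  apply: (mulfI k0); apply: (mulfI three0).
  by apply: (eq_lincomb 1 e4); rewrite aE bE; ring.
have p0 : 3%:R * c ^+ 2 - 1 != 0.
  apply/eqP=> p0; have /eqP : (2%:R * c) ^+ 2 = 0.
    by apply: (eq_lincomb2 3%:R (3%:R * mu - c ^+ 2) E1 p0); ring.
  by rewrite sqrf_eq0 (negPf tc0).
have u1 : 1 - c ^+ 2 != 0.
  apply/eqP=> u1; have /eqP : 2%:R * (1 - mu) = 0.
    by apply: (eq_lincomb2 1 (2%:R + c ^+ 2 - 3%:R * mu) E1 u1); ring.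
  by rewrite mulf_eq0 (negPf two0) (negPf mu1').
have E2 : 2%:R * k ^+ 3 * (9%:R * c ^+ 2 - 1) = 1.
  apply: (mulfI u1); apply: (mulfI c0).
  by apply: (eq_lincomb 1 e1); rewrite aE bE; ring.
(* [B] eliminates k^3 through [E2], and [C] eliminates mu through [E1]. With u = c^2, the two sides
   of [C] differ by -9 u (1 - u)^2 (3 u^2 + 6 u - 1). *)
have E3 : 3%:R * c ^+ 4 + 6%:R * c ^+ 2 = 1.
  pose p := 3%:R * c ^+ 2 - 1.
  have A : p * (4%:R * c ^+ 2 - mu * p ^+ 2) * k ^+ 3 = mu - c ^+ 2.
    by apply: (eq_lincomb 1 e2); rewrite aE bE /p; ring.
  have B : p * (4%:R * c ^+ 2 - mu * p ^+ 2) =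
           2%:R * (9%:R * c ^+ 2 - 1) * (mu - c ^+ 2).
    by apply: (eq_lincomb2 (2%:R * (9%:R * c ^+ 2 - 1))
      (- p * (4%:R * c ^+ 2 - mu * p ^+ 2)) A E2); ring.
  have C : p ^+ 2 * (4%:R * c ^+ 2 - c ^+ 2 * (c ^+ 2 + 1) * p) =
           2%:R * (9%:R * c ^+ 2 - 1) * (c ^+ 2 * (c ^+ 2 + 1) - c ^+ 2 * p).
    by apply: (eq_lincomb2 p (- p ^+ 3 - 2%:R * (9%:R * c ^+ 2 - 1)) B E1);
      rewrite /p; ring.
  do 2!apply: (mulfI u1); do 2!apply: (mulfI c0); do 2!apply: (mulfI three0).
  by apply: (eq_lincomb (- 1) C); rewrite /p; ring.
(* By [E1] and [E3], 3 mu (3u - 1) = 3 u^2 + 3 u = -(3u - 1). *)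
exists k; split=> //; apply: (mulfI p0).
by apply: (eq_lincomb2 (-3%:R) 1 E1 E3); ring.
Qed.

Lemma transporter_exists (F : fieldType) (mu w h : F) :
  2%:R != 0 :> F -> 3%:R != 0 :> F -> mu * 3%:R = - 1 ->
  w ^+ 4 = 12%:R -> h ^+ 3 = 2%:R^-1 ->
  exists a b c, a - b * c != 0 /\ transporter_eqs mu a b c 1.
Proof.
move=> two0 three0 muE wE hE.
pose r := w ^+ 2 / 2%:R; have r2 : r ^+ 2 = 3%:R.
  rewrite /r expr_div_n -exprM wE; apply: (mulIf (expf_neq0 2 two0)).
  by rewrite divfK ?expf_neq0 //; ring.
have w2 : w ^+ 2 = 2%:R * r by rewrite /r; field.
have w0 : w != 0.
  have : 2%:R * 2%:R * 3%:R != 0 :> F by rewrite !mulf_neq0.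
  by apply: contraNneq => w0; apply/eqP; move: wE; rewrite w0 => wE;
    apply: (eq_lincomb (- 1) wE); ring.
have r0 : r != 0 by rewrite mulf_neq0 ?invr_eq0 ?sqrf_eq0.
have r1 : r - 1 != 0.
  apply: contraNneq two0 => r1; apply/eqP.
  by apply: (eq_lincomb2 (r + 1) (-1) r1 r2); ring.
(* As w^2 = 2 r, this c has c^2 = (r - 1)^2 / (2 r); k is chosen because 9 c^2 - 1 = (r - 1)^3. *)
pose c := (r - 1) / w; pose k := h / (r - 1).
have uE : c ^+ 2 * r = 2%:R - r.
  rewrite /c expr_div_n w2; apply: (mulfI two0).
  by apply: (eq_lincomb 1 r2); field; rewrite r0.
have E3 : 3%:R * c ^+ 4 + 6%:R * c ^+ 2 = 1.
  do 2!apply: (mulfI r0).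
  by apply: (eq_lincomb2 (3%:R * (c ^+ 2 * r + 2%:R - r) + 6%:R * r) (- 4%:R) uE r2); ring.
have E2 : 2%:R * k ^+ 3 * (9%:R * c ^+ 2 - 1) = 1.
  have -> : 9%:R * c ^+ 2 - 1 = (r - 1) ^+ 3.
    apply: (mulfI r0).
    by apply: (eq_lincomb2 9%:R (- (r ^+ 2 - 3%:R * r + 6%:R)) uE r2); ring.
  by rewrite /k expr_div_n hE; field; rewrite r1.
(* This is three times the second equation at mu = -1/3, with a and b substituted. *)
have E4 : k ^+ 3 * (3%:R * c ^+ 2 - 1) *
    (12%:R * c ^+ 2 + (3%:R * c ^+ 2 - 1) ^+ 2) + 3%:R * c ^+ 2 + 1 = 0.
  by apply: (eq_lincomb2 (k ^+ 3 * (9%:R * c ^+ 2 + 3%:R))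
    (- (3%:R * c ^+ 2 + 1)) E3 E2); ring.
have c0 : c != 0 by rewrite mulf_neq0 ?invr_eq0.
clearbody c k.
have k0 : k != 0.
  by apply: contra_eq_neq E2 => ->; rewrite expr0n /= mulr0 mul0r eq_sym oner_eq0.
have u1 : 1 - c ^+ 2 != 0.
  apply: contraNneq (expf_neq0 3 two0) => u1; apply/eqP.
  by apply: (eq_lincomb2 1 (3%:R * c ^+ 2 + 9%:R) E3 u1); ring.
exists (2%:R * c * k), ((3%:R * c ^+ 2 - 1) * k), c; split.
  have -> : 2%:R * c * k - (3%:R * c ^+ 2 - 1) * k * c =
    3%:R * c * k * (1 - c ^+ 2) by ring.
  by rewrite !mulf_neq0.
split.
- by apply: (eq_lincomb (c * (1 - c ^+ 2)) E2); ring.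
- apply: (mulfI three0).
  by apply: (eq_lincomb2 (- ((3%:R * c ^+ 2 - 1) ^+ 3 * k ^+ 3 + 1)) 1 muE E4); ring.
- by ring.
- by apply: (eq_lincomb2 k (- (3%:R * c ^+ 2 - 1) * k) E3 muE); ring.
Qed.

Lemma transporter_iff (F : fieldType) (mu : F) : mu != 1 ->
  (exists a b c d, a * d - b * c != 0 /\ transporter_eqs mu a b c d) <->
  [/\ 2%:R != 0 :> F, 3%:R != 0 :> F, mu = - 3%:R^-1,
     exists w : F, w ^+ 4 = 12%:R & exists h : F, h ^+ 3 = 2%:R^-1].
Proof.
move=> mu1; split=> [[a [b [c [d [det0 eqs]]]]]|[two0 three0 -> [w wE] [h hE]]].
  have two0 := transporter_two_neq0 _ _ _ _ _ _ mu1 det0 eqs.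
  have three0 := transporter_three_neq0 _ _ _ _ _ _ det0 eqs.
  have [a' [b' [c' [c0 det0' eqs']]]] :=
    transporter_normalize _ _ _ _ _ _ three0 det0 eqs.
  have [k [E2 E3 muE]] := transporter_param _ _ _ _ _ two0 three0 mu1 c0 det0' eqs'.
  split=> //.
  - by apply: (mulIf three0); rewrite muE mulNr mulVf.
  - exists ((3%:R * c' ^+ 2 + 1) / (2%:R * c')).
    have den0 : (2%:R * c') ^+ 4 != 0 by rewrite expf_neq0 ?mulf_neq0.
    rewrite expr_div_n; apply: (mulIf den0); rewrite divfK //.
    by apply: (eq_lincomb (3%:R * ((3%:R * c' ^+ 2 + 1) ^+ 2 + 4%:R - 12%:R * c' ^+ 2)
      - 16%:R) E3); ring.
  exists (k * (3%:R * c' ^+ 2 + 1) / 2%:R).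
  rewrite expr_div_n; apply: (mulIf (expf_neq0 3 two0)).
  rewrite divfK ?expf_neq0 // (exprS (2%:R : F) 2) mulKf //.
  by apply: (eq_lincomb2 4%:R (9%:R * k ^+ 3 * (c' ^+ 2 - 1)) E2 E3); ring.
have muE : - 3%:R^-1 * 3%:R = - 1 :> F by rewrite mulNr mulVf.
have [a [b [c [det0 eqs]]]] := transporter_exists _ _ _ _ two0 three0 muE wE hE.
by exists a, b, c, 1; rewrite mulr1.
Qed.

(** * Power residues in finite fields and congruences on q *)

(** The order of F is a positive power of its characteristic. *)
Lemma natr_prime_neq0 (F : finFieldType) p : prime p ->
  (p%:R != 0 :> F) = ~~ (p %| #|F|)%N.
Proof.
move=> p_pr; have [c c_pr cF] := finPcharP F.
have /p_natP[n Fn] : (c.-nat #|F|)%N.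
  by rewrite -cardsT; apply: pprimeChar_pgroup cF.
have n0 : (0 < n)%N by case: n Fn (finNzRing_gt1 F) => // ->.
by rewrite Fn Euclid_dvdX // n0 andbT -(dvdn_pcharf cF) !dvdn_prime2 // eq_sym.
Qed.

Lemma expf_card_pred (F : finFieldType) (x : F) : x != 0 -> x ^+ #|F|.-1 = 1.
Proof.
move=> x0; apply: (mulfI x0); rewrite -exprS prednK ?expf_card ?mulr1 //.
by rewrite (cardD1 x).
Qed.

(** X^m - 1 has at most m roots. This stands in for a generator of the multiplicative group. *)
Lemma exists_expf_neq1 (F : finFieldType) m : (0 < m < #|F|.-1)%N ->
  exists2 x : F, x != 0 & x ^+ m != 1.
Proof.
case/andP=> m0 mq; apply/exists_inP; apply: contraLR mq => /exists_inPn x1.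
rewrite -leqNgt; pose rs := enum [pred x : F | x != 0].
have -> : #|F|.-1 = size rs by rewrite -cardE -(cardC1 (0 : F)); apply: eq_card.
apply: max_unity_roots => //; last exact: enum_uniq.
by apply/allP=> x; rewrite mem_enum inE => /x1; rewrite negbK unity_rootE.
Qed.

(** If q = 3 mod 4, then i = i^q = i^3 = -i. If q = 1 mod 4, take x^((q-1)/4) with x^((q-1)/2)
    different from 1. *)
Lemma sqrtN1_mod4 (F : finFieldType) : odd #|F| ->
  (exists i : F, i ^+ 2 = - 1) <-> (#|F| %% 4 = 1)%N.
Proof.
move=> oddF; have q1 : (1 < #|F|)%N := finNzRing_gt1 F.
have two0 : 2%:R != 0 :> F by rewrite natr_prime_neq0 // dvdn2 oddF.
split=> [[i i2]|q4].
  have [//|q4] : (#|F| %% 4 = 1 \/ #|F| %% 4 = 3)%N by lia.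
  have := expf_card i; rewrite (divn_eq #|F| 4) q4 exprD mulnC exprM.
  have -> : i ^+ 4 = 1 by rewrite (exprM i 2 2) i2 sqrrN expr1n.
  rewrite expr1n mul1r exprS i2 mulrN1 => /esym iN.
  have /eqP : 2%:R * i = 0 by apply: (eq_lincomb 1 iN); ring.
  rewrite mulf_eq0 (negPf two0) => /eqP i0.
  by move/eqP: i2; rewrite i0 expr0n eq_sym oppr_eq0 oner_eq0.
pose m := (#|F| %/ 4)%N; have qE : #|F|.-1 = (m * 4)%N by lia.
have [|x x0 x1] := exists_expf_neq1 F (m * 2)%N; first by lia.
exists (x ^+ m); rewrite -exprM; apply/eqP.
have : (x ^+ (m * 2)) ^+ 2 == 1 by rewrite -exprM -mulnA -qE expf_card_pred.
by rewrite sqrf_eq1 (negPf x1).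
Qed.

(** The relation y = 2 z + 1 matches square roots of -3 with roots of z^2 + z + 1, the primitive
    cube roots of unity. *)
Lemma sqrtN3_mod3 (F : finFieldType) : odd #|F| -> (#|F| %% 3 != 0)%N ->
  (exists y : F, y ^+ 2 = - 3%:R) <-> (#|F| %% 3 = 1)%N.
Proof.
move=> oddF q3; have q1 : (1 < #|F|)%N := finNzRing_gt1 F.
have two0 : 2%:R != 0 :> F by rewrite natr_prime_neq0 // dvdn2 oddF.
have three0 : 3%:R != 0 :> F by rewrite natr_prime_neq0.
split=> [[y y2]|{}q3].
  have [//|{}q3] : (#|F| %% 3 = 1 \/ #|F| %% 3 = 2)%N by lia.
  pose z := (y - 1) / 2%:R.
  have yE : y = 2%:R * z + 1 by rewrite /z; field.
  have z2 : z ^+ 2 + z + 1 = 0.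
    do 2!apply: (mulfI two0); apply: (eq_lincomb 1 y2); rewrite yE; ring.
  have z3 : z ^+ 3 = 1 by apply: (eq_lincomb (z - 1) z2); ring.
  have := expf_card z; rewrite (divn_eq #|F| 3) q3.
  rewrite exprD mulnC exprM z3 expr1n mul1r => zz.
  have z1 : z = 1.
    by apply: (eq_lincomb2 1 (- (z + 1)) z3 zz); ring.
  by move/eqP: z2; rewrite z1 expr1n (_ : 1 + 1 + 1 = 3%:R) ?(negPf three0) //; ring.
pose m := (#|F| %/ 3)%N; have qE : #|F|.-1 = (m * 3)%N by lia.
have [|x x0 x1] := exists_expf_neq1 F m; first by lia.
have z3 : (x ^+ m) ^+ 3 = 1 by rewrite -exprM -qE expf_card_pred.
exists (2%:R * x ^+ m + 1).
have z10 : x ^+ m - 1 != 0 by rewrite subr_eq0.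
by apply: (mulfI z10); apply: (eq_lincomb 4%:R z3); ring.
Qed.

Lemma sqr_or_opp_mod4 (F : finFieldType) (x : F) : (#|F| %% 4 = 3)%N ->
  exists y, y ^+ 2 = x \/ y ^+ 2 = - x.
Proof.
move=> q4; have [->|x0] := eqVneq x 0; first by exists 0; left; rewrite expr0n.
pose m := (#|F| %/ 4)%N; have qE : #|F|.-1 = (m.*2.+1 * 2)%N by lia.
(* Here m + 1 = (q + 1) / 4, so the square is x times x^((q-1)/2), which is x or -x. *)
exists (x ^+ m.+1); rewrite -exprM (_ : (m.+1 * 2 = m.*2.+1.+1)%N) ?exprS; last by lia.
have : (x ^+ m.*2.+1) ^+ 2 == 1 by rewrite -exprM -qE expf_card_pred.
rewrite sqrf_eq1 exprS => /orP[]/eqP ->; [left | right]; ring.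
Qed.

Lemma cube_mod3 (F : finFieldType) (x : F) : (#|F| %% 3 = 2)%N ->
  exists y, y ^+ 3 = x.
Proof.
move=> q3; have [->|x0] := eqVneq x 0; first by exists 0; rewrite expr0n.
(* The exponent is (2q - 1) / 3, and x^(2q-1) = x^q x^(q-1) = x. *)
pose m := (#|F| %/ 3)%N; exists (x ^+ m.*2.+1).
have qE : (m.*2.+1 * 3 = #|F| + #|F|.-1)%N by lia.
by rewrite -exprM qE exprD expf_card expf_card_pred // mulr1.
Qed.

Lemma fourth_power_12_cube_iff (F : finFieldType) (mu : F) :
  [/\ 2%:R != 0 :> F, 3%:R != 0 :> F, mu = - 3%:R^-1,
     exists w : F, w ^+ 4 = 12%:R & exists h : F, h ^+ 3 = 2%:R^-1] <->
  [/\ odd #|F|, mu = - 3%:R^-1 &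
     ((#|F| %% 12 = 11)%N /\ ~ (exists y : F, y ^+ 2 = mu))
     \/ [/\ (#|F| %% 12 = 1)%N, (exists y : F, y ^+ 2 = mu),
            (exists y : F, y ^+ 3 = 2%:R^-1)
          & (exists y : F, y ^+ 4 = - 3%:R^-1)]].
Proof.
have pow4 (i : F) : i ^+ 2 = - 1 -> (1 + i) ^+ 4 = - 4%:R.
  by move=> i2; apply: (eq_lincomb (i ^+ 2 + 4%:R * i + 5%:R) i2); ring.
split=> [[two0 three0 muE [w wE] [h hE]]|[oddF muE cases]].
  have oddF : odd #|F| by move: two0; rewrite natr_prime_neq0 // dvdn2 negbK.
  have q3 : (#|F| %% 3 != 0)%N by move: three0; rewrite natr_prime_neq0.
  have twelve0 : 12%:R != 0 :> F.
    have -> : 12%:R = 2%:R * 2%:R * 3%:R :> F by ring.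
    by rewrite !mulf_neq0.
  have w0 : w != 0.
    by apply: contraNneq twelve0 => w0; rewrite -wE w0 expr0n.
  pose s := w ^+ 2 / 2%:R; have s2 : s ^+ 2 = 3%:R.
    rewrite /s expr_div_n -exprM wE; apply: (mulIf (expf_neq0 2 two0)).
    by rewrite divfK ?expf_neq0 //; ring.
  split=> //.
  (* Since 3 = s^2, -1 and -3 are squares together, so q is 1 or -1 mod 12. *)
  have [q4|q4] : (#|F| %% 4 = 1 \/ #|F| %% 4 = 3)%N by lia.
    have [_ /(_ q4)[i i2]] := sqrtN1_mod4 _ oddF.
    have {}q3 : (#|F| %% 3 = 1)%N.
      by apply/sqrtN3_mod3 => //; exists (i * s); rewrite exprMn i2 s2 mulN1r.
    have yE : ((1 + i) / w) ^+ 4 = - 3%:R^-1.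
      rewrite expr_div_n pow4 // wE; apply: (mulIf twelve0).
      by rewrite divfK // (_ : 12%:R = 3%:R * 4%:R) ?mulNr ?mulKf //; ring.
    right; split; [lia | | by exists h | by exists ((1 + i) / w)].
    by exists (((1 + i) / w) ^+ 2); rewrite -exprM muE.
  left; have q31 : (#|F| %% 3 != 1)%N.
    apply/eqP=> q31; have [_ /(_ q31)[y y2]] := sqrtN3_mod3 _ oddF q3.
    suff : (#|F| %% 4 = 1)%N by lia.
    apply/sqrtN1_mod4 => //; exists (y / s).
    by rewrite expr_div_n y2 s2 mulNr mulfV.
  split; first by lia.
  case=> y yE; move/eqP: q31; apply; apply/sqrtN3_mod3 => //.
  by exists (3%:R * y); rewrite exprMn yE muE; field; rewrite three0.
have two0 : 2%:R != 0 :> F by rewrite natr_prime_neq0 // dvdn2 oddF.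
have three0 : 3%:R != 0 :> F.
  by rewrite natr_prime_neq0 //; case: cases => [[q12 _]|[q12 _ _ _]]; lia.
case: cases => [[q12 _]|[q12 _ [h hE] [y yE]]].
  have q4 : (#|F| %% 4 = 3)%N by lia.
  have [h hE] := cube_mod3 F 2%:R^-1 ltac:(lia).
  (* For q = -1 mod 12, -3 is not a square, so 3 is. One of 2 s and -2 s is then a square w^2, and
     w^4 = 4 s^2 = 12. *)
  have [s s2] : exists s : F, s ^+ 2 = 3%:R.
    have [s [|s2]] := sqr_or_opp_mod4 F 3%:R q4; first by exists s.
    suff : (#|F| %% 3 = 1)%N by lia.
    by apply/sqrtN3_mod3; [done | lia | exists s].
  have [w wE] := sqr_or_opp_mod4 F (2%:R * s) q4.
  split=> //; [exists w | by exists h].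
  rewrite (exprM w 2 2); case: wE => ->; rewrite ?sqrrN exprMn s2; ring.
have q4 : (#|F| %% 4 = 1)%N by lia.
have [_ /(_ q4)[i i2]] := sqrtN1_mod4 _ oddF.
(* The fourth power is -4 / (-1/3) = 12. *)
split=> //; [exists ((1 + i) / y) | by exists h].
by rewrite expr_div_n pow4 // yE invrN invrK; ring.
Qed.

Theorem theorem7p7 (F : finFieldType) (mu : F) :
  (5 <= #|F|)%N ->
  mu != 0 -> mu != 1 ->
  (odd #|F| -> (#|F| %% 3 != 0)%N -> mu != 9%:R^-1) ->
  same_orbit (L_c F) (ell mu) <->
  [/\ odd #|F|, mu = - 3%:R^-1 &
     ((#|F| %% 12 = 11)%N /\ ~ (exists y : F, y ^+ 2 = mu))
     \/ [/\ (#|F| %% 12 = 1)%N, (exists y : F, y ^+ 2 = mu),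
            (exists y : F, y ^+ 3 = 2%:R^-1)
          & (exists y : F, y ^+ 4 = - 3%:R^-1)]].
Proof.
move=> F5 _ mu1 _.
by rewrite -fourth_power_12_cube_iff -transporter_iff //; apply: same_orbit_iff.
Qed.
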